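(* Let $\mathbf F$ be a finite field, let $k \in \mathbb N$, and let $\mathbf B$ be an $\mathbf R$-module such that $|F|$ is invertible in $\mathbf R$. Then the set $\mathcal O_{F^k,B}$ of all finitary operations from $F^k$ to $B$ is uniformly generated by $k$-ary $(\mathbf F^k,\mathbf B)$-minors.
   Context: $\mathbb N=\{1,2,\dots\}$. Rings are unital (not necessarily commutative), modules are left modules; ''$|F|$ is invertible in $\mathbf R$'' means $|F|\cdot 1_{\mathbf R}$ is a unit. $\mathbf F^k$ denotes the $k$-dimensional vector space over $\mathbf F$ (as an $\mathbf F$-module). For sets $A,B$, $\mathcal O_{A,B}=\bigcup_{m\ge 1}B^{A^m}$ is the set of all finitary operations from $A$ to $B$; for $U\subseteq\mathcal O_{A,B}$, $U^{(m)}=U\cap B^{A^m}$. A module $\mathbf A$ over a ring $\mathbf S$ is viewed as a one-sorted algebra $(A,+,0,-,(s)_{s\in S})$ with each ring element acting as a unary operation. Its $m$-ary term operations are the maps $\sum_{i=1}^m s_ix_i$ with $s_i\in S$; $\mathrm{Clo}(\mathbf A)$ is the set of all term operations. For an algebra $\mathbf A$ and $n,k',l\in\mathbb N$, $R_n^{k',l}(\mathbf A)$ is the set of all maps $r\colon A^{k'}\to A^{l}$ of the form $r=v\circ w$ with $w\colon A^{k'}\to A^n$ and $v\colon A^n\to A^l$, where each coordinate function of $w$ and of $v$ is a term operation of $\mathbf A$. A set $U\subseteq B^{A^{m}}$ is uniformly generated by $n$-ary $(\mathbf A,\mathbf B)$-minors if there are $p\in\mathbb N$, a $p$-ary term operation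 $s$ of $\mathbf B$, and $r_1,\dots,r_p\in R_n^{m,m}(\mathbf A)$ such that $f=s\circ(f\circ r_1,\dots,f\circ r_p)$ for every $f\in U$ (with $s, r_1,\dots,r_p$ not depending on $f$). A set $U\subseteq\mathcal O_{A,B}$ is uniformly generated by $n$-ary $(\mathbf A,\mathbf B)$-minors if $U^{(m)}$ is, for every $m\in\mathbb N$. Identifying $(F^k)^m$ with $F^{m\times k}$ (the $i$-th argument being the $i$-th row), the maps in $R_n^{m,m}(\mathbf F^k)$ are exactly $X\mapsto MX$ with $M\in F^{m\times m}$, $\mathrm{rk}(M)\le n$. So the claim says that for each $m$ there are coefficients $\alpha_M\in R$ with $f(X)=\sum_{\mathrm{rk}(M)\le k}\alpha_Mf(MX)$ for all $f\colon F^{m\times k}\to B$ and all $X$. *)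

(* Defs.v *)
From HB Require Import structures.
From mathcomp Require Import all_boot all_order all_algebra.

Set Implicit Arguments.
Unset Strict Implicit.
Unset Printing Implicit Defensive.

Import GRing.Theory.
Local Open Scope ring_scope.

Record algebra := MkAlgebra {
  carrier :> Type;
  op_symb : Type;
  arity : op_symb -> nat;
  interp : forall o : op_symb, {ffun 'I_(arity o) -> carrier} -> carrier
}.

Inductive term (A : algebra) (m : nat) : Type :=
| Var of 'I_m
| App (o : op_symb A) of ('I_(arity o) -> term A m).

Arguments Var {A m} i.
Arguments App {A m} o args.

Fixpoint term_eval (A : algebra) (m : nat) (t : term A m)
    (x : {ffun 'I_m -> A}) : A :=
  match t with
  | Var i => x i
  | App o args => interp [ffun i => term_eval (args i) x]
  end.

Definition term_operation (A : algebra) (m : nat)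
    (f : {ffun 'I_m -> A} -> A) : Prop :=
  exists t : term A m, forall x, f x = term_eval t x.

Inductive module_op (S : Type) := OpAdd | OpZero | OpOpp | OpScale of S.

Definition module_arity (S : Type) (o : module_op S) : nat :=
  match o with OpAdd => 2 | OpZero => 0 | OpOpp | OpScale _ => 1 end.

Definition module_interp (S : pzRingType) (A : lmodType S) (o : module_op S) :
    {ffun 'I_(module_arity o) -> A} -> A :=
  match o return {ffun 'I_(module_arity o) -> A} -> A with
  | OpAdd => fun x => x ord0 + x ord_max
  | OpZero => fun=> 0
  | OpOpp => fun x => - x ord0
  | OpScale s => fun x => s *: x ord0
  end.

Definition module_algebra (S : pzRingType) (A : lmodType S) : algebra :=
  MkAlgebra (@module_interp S A).

Arguments module_algebra S A : clear implicits.

(* [factors_through n k l r]: the map r belongs to R_n^{k,l}(A). *)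
Definition factors_through (A : algebra) (n k l : nat)
    (r : {ffun 'I_k -> A} -> {ffun 'I_l -> A}) : Prop :=
  exists (w : {ffun 'I_k -> A} -> {ffun 'I_n -> A})
         (v : {ffun 'I_n -> A} -> {ffun 'I_l -> A}),
    [/\ forall i, term_operation (fun x => w x i),
        forall i, term_operation (fun y => v y i)
      & forall x, r x = v (w x)].

(* Sets of finitary operations from A to B, sorted by arity: [U m] is the
   m-ary part of U.  Only the arities m >= 1 are meaningful. *)
Definition operation_set (A B : Type) : Type :=
  forall m : nat, ({ffun 'I_m -> A} -> B) -> Prop.

Definition all_operations (A B : Type) : operation_set A B := fun _ _ => True.

Arguments all_operations A B : clear implicits.

Definition uniformly_generated_arity (A B : algebra) (n m : nat)
    (U : ({ffun 'I_m -> A} -> B) -> Prop) : Prop :=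
  exists (p : nat) (s : {ffun 'I_p -> B} -> B)
         (r : 'I_p -> {ffun 'I_m -> A} -> {ffun 'I_m -> A}),
    [/\ (0 < p)%N, term_operation s,
        forall j, factors_through n (r j)
      & forall f, U f -> forall x, f x = s [ffun j => f (r j x)]].

Definition uniformly_generated (A B : algebra) (n : nat)
    (U : operation_set A B) : Prop :=
  forall m : nat, (0 < m)%N -> uniformly_generated_arity n (U m).

Arguments uniformly_generated A B n U : clear implicits.

Definition invertible (R : pzRingType) (a : R) : Prop :=
  exists b : R, a * b = 1 /\ b * a = 1.

Lemma term_operation_moduleP (S : pzRingType) (A : lmodType S) (m : nat)
    (f : {ffun 'I_m -> A} -> A) :
  @term_operation (module_algebra S A) m f <->
  exists s : 'I_m -> S, forall x, f x = \sum_i s i *: x i.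
Proof.
split=> [[t ft]|[s fs]].
  suff [s Hs] : exists s : 'I_m -> S,
      forall x, term_eval t x = \sum_i s i *: x i :> A.
    by exists s => x; rewrite ft Hs.
  elim: t {f ft} => [j|o args IH].
    exists (fun i => (i == j)%:R) => x /=.
    rewrite (bigD1 j) //= eqxx scale1r big1 ?addr0 // => i /negPf ->.
    exact: scale0r.
  case: o args IH => [|||a] args IH.
  - have [s0 H0] := IH ord0; have [s1 H1] := IH ord_max.
    exists (fun i => s0 i + s1 i) => x /=; rewrite !ffunE H0 H1 -big_split.
    by apply: eq_bigr => i _; rewrite scalerDl.
  - exists (fun=> 0) => x /=; rewrite big1 // => i _; exact: scale0r.
  - have [s0 H0] := IH ord0.
    exists (fun i => - s0 i) => x /=; rewrite ffunE H0 -sumrN.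
    by apply: eq_bigr => i _; rewrite scaleNr.
  - have [s0 H0] := IH ord0.
    exists (fun i => a * s0 i) => x /=; rewrite ffunE H0 scaler_sumr.
    by apply: eq_bigr => i _; rewrite scalerA.
suff [t Ht] : exists t : term (module_algebra S A) m,
    forall x, term_eval t x = \sum_i s i *: x i :> A.
  by exists t => x; rewrite Ht fs.
elim: (index_enum _) => [|i r [t Ht]].
  exists (@App (module_algebra S A) m (OpZero S)
    (fun i => Var (match i with Ordinal _ h => False_rect _ (notF h) end))).
  by move=> x; rewrite big_nil.
exists (@App (module_algebra S A) m (OpAdd S) (fun j : 'I_2 =>
  if j == ord0
  then @App (module_algebra S A) m (OpScale (s i)) (fun=> Var i)
  else t)).
by move=> x; rewrite big_cons -Ht /= !ffunE /= !ffunE.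
Qed.

(* Main.v *)
(** Write q = |F|. We find coefficients c(M), for M an m x m matrix, such that
    c(1) = 1, c(M) = 0 for every other invertible M, and sum_M c(M) f(MA) = 0
    for all f and all m x k matrices A with k < m: this rewrites f(A) in terms
    of matrices of rank < m, and one concludes by descending induction on the
    rank.

    Let c(M) = 0 unless M is the direct sum of an identity of size b and a
    nilpotent, and put c(M) = (-1)^(m-b) q^-(b + (b+1) + ... + (m-1)) in that
    case. As A has rank < m, pA = 0 for some row p != 0, so it is enough to
    show sum_w c(M + wp) = 0, where w ranges over all columns. If some term is
    nonzero, translate w so that M = N with N stable (N^(m+1) = N^m) and p N^m
    = 0; let b be the rank of N^m. A matrix M is stable iff (1 - X)(1 - XM)^-1
    is polynomial in X, and its value at X = 1 is then M^m. As T(v) = p (1 -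
    XN)^-1 v is polynomial too, the Sherman-Morrison formula shows that the
    stable matrices among the N + vp are of two kinds:
    - T(v) = 0, and the stable rank is b;
    - T(v) = 1 and N^m v = 0, and the stable rank is b + 1.
    There are q^b times as many v of the first kind as of the second, and the
    weights are chosen so that both contributions cancel. *)

Require Import Defs.
From HB Require Import structures.
From mathcomp Require Import all_boot all_order all_algebra.
From mathcomp Require Import ring mxabelem.

Set Implicit Arguments.
Unset Strict Implicit.
Unset Printing Implicit Defensive.

Import GRing.Theory.
Local Open Scope ring_scope.

Local Notation polymx := (map_mx polyC).
Local Notation at1 := (map_mx (horner_eval 1)).

Lemma exists_mulmx_eq1 (F : fieldType) (m n : nat) (W : 'M[F]_(m, n))
    (p : 'rV_n) : ~~ (p <= W)%MS ->
  exists2 v : 'cV_n, W *m v = 0 & p *m v = 1%:M.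
Proof.
rewrite submxE; have := mulmx_coker W; move: (cokermx W) => C WC /rV0Pn [j pCj].
exists (((p *m C) 0 j)^-1 *: col j C); rewrite colE -scalemxAr mulmxA.
  by rewrite WC mul0mx scaler0.
by move: (p *m C) pCj => w wj; rewrite -colE [LHS]mx11_scalar !mxE mulVf.
Qed.

Lemma capmx_idempotent_eq0 (F : fieldType) (m n : nat) (A : 'M[F]_(m, n))
    (P : 'M_n) : P *m P = P -> A *m P = 0 -> (A :&: P)%MS = 0.
Proof.
move=> PP AP; apply/eqP; rewrite -submx0; apply/row_subP => i.
have := row_sub i (A :&: P)%MS.
rewrite sub_capmx => /andP[/submxP[a aA] /submxP[b bP]].
by rewrite bP -PP mulmxA -bP aA -mulmxA AP mulmx0 sub0mx.
Qed.

Lemma mxrank_add_orthogonal_idempotent (F : fieldType) (n : nat)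
    (P Q : 'M[F]_n) : P *m P = P -> P *m Q = 0 -> Q *m P = 0 ->
  \rank (P + Q)%R = (\rank P + \rank Q)%N.
Proof.
move=> PP PQ QP; have P_sub : (P <= (P + Q)%R)%MS.
  by apply/submxP; exists P; rewrite mulmxDr PP PQ addr0.
rewrite addnC -mxrank_disjoint_sum ?capmx_idempotent_eq0 // addsmxC.
apply: eqmx_rank; apply/andP; split; first exact: addmx_sub_adds.
by rewrite addsmx_sub P_sub -[X in (X <= _)%MS](addKr P) addmx_sub ?eqmx_opp.
Qed.

Lemma mx_factor_through (F : fieldType) (m n r : nat) (M : 'M[F]_(m, n)) :
  (\rank M <= r)%N -> exists (A : 'M_(m, r)) (C : 'M_(r, n)), M = A *m C.
Proof.
move=> rM; exists (col_ebase M *m pid_mx (\rank M)).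
exists (pid_mx (\rank M) *m row_ebase M).
rewrite !mulmxA -(mulmxA (col_ebase M)) mul_pid_mx minnn (minn_idPr rM).
by rewrite mulmx_ebase.
Qed.

Lemma card_mulmx_solutions (F : finFieldType) (m n : nat) (A : 'M[F]_(m, n))
    (b : 'cV_m) (v0 : 'cV_n) : A *m v0 = b ->
  #|[set v | A *m v == b]| = (#|F| ^ (n - \rank A))%N.
Proof.
move=> Av0; rewrite -(mxrank_tr A) -mxrank_ker -card_rowg.
have translate_inj : injective (fun u : 'rV[F]_n => v0 + u^T).
  by move=> u u' /addrI /trmx_inj.
rewrite -(card_imset _ translate_inj); apply: eq_card => v; rewrite inE.
apply/eqP/imsetP => [Av|[u]].
  exists (v - v0)^T; last by rewrite trmxK addrC subrK.
  rewrite mem_rowg; apply/sub_kermxP.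
  by rewrite -trmx_mul mulmxBr Av Av0 subrr trmx0.
rewrite mem_rowg => /sub_kermxP uA ->.
by rewrite mulmxDr Av0 -[A *m _]trmxK trmx_mul trmxK uA trmx0 addr0.
Qed.

Lemma expr_stable_leq (R : pzRingType) (x : R) (i j : nat) :
  x ^+ i.+1 = x ^+ i -> (i <= j)%N -> x ^+ j = x ^+ i.
Proof.
move=> xi /subnK <-; elim: (j - i)%N => [//|d IHd].
by rewrite addSn exprS IHd -exprS.
Qed.

Lemma mulmx_expr_eq0 (F : fieldType) (n m k : nat) (M : 'M[F]_n.+1)
    (Y : 'M_(n.+1, m)) : M ^+ k *m Y = 0 -> M ^+ n.+1 *m Y = 0.
Proof.
move=> MkY; pose chi : {poly F} := char_poly M.
have [[u v] /= bezout] := Bezoutp chi 'X^k.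
have /dvdpP [w Xn] : u * chi + v * 'X^k %| 'X^(n.+1).
  rewrite (eqp_dvdl _ bezout).
  have /dvdp_exp_XsubCP [i _ gcdE] : gcdp chi 'X^k %| ('X - 0%:P) ^+ k.
    by rewrite subr0 dvdp_gcdr.
  rewrite subr0 in gcdE; rewrite (eqp_dvdl _ gcdE) dvdp_exp2l //.
  rewrite -ltnS -(size_polyXn F i) -(eqp_size gcdE) -(size_char_poly M).
  by rewrite dvdp_leq ?dvdp_gcdl ?monic_neq0 ?char_poly_monic.
rewrite -(horner_mx_X M) -rmorphXn Xn rmorphM rmorphD 2!rmorphM rmorphXn /=.
rewrite horner_mx_X Cayley_Hamilton mulr0 add0r -!mulmxE -!mulmxA MkY.
by rewrite !mulmx0.
Qed.

Lemma mx_expr_stable (F : fieldType) (n k : nat) (M : 'M[F]_n.+1) :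
  M ^+ k.+1 = M ^+ k -> M ^+ n.+2 = M ^+ n.+1.
Proof.
have diffE i : M ^+ i *m (M - 1) = M ^+ i.+1 - M ^+ i.
  by rewrite mulmxBr mulmxE -exprSr mulr1.
move=> Mk; apply/eqP; rewrite -subr_eq0 -diffE; apply/eqP.
by apply: (@mulmx_expr_eq0 _ _ _ k); rewrite diffE Mk subrr.
Qed.

Section Resolvent.

Variables (R : comNzRingType) (n : nat).
Implicit Types (M : 'M[R]_n.+1) (S : 'M[{poly R}]_n.+1).

(* Over a field the powers of M, if they stabilize at all, do so from the
   exponent n.+1 on ([mx_expr_stable]). *)
Definition power_stable M : bool := M ^+ n.+2 == M ^+ n.+1.

Definition mx_limit M : 'M[R]_n.+1 := M ^+ n.+1.

Lemma mx_limit_mul_expr M i :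
  power_stable M -> mx_limit M *m M ^+ i = mx_limit M.
Proof.
move=> /eqP M_stable; rewrite mulmxE -exprD.
by rewrite (expr_stable_leq M_stable) ?leq_addr.
Qed.

Lemma expr_mul_mx_limit M i :
  power_stable M -> M ^+ i *m mx_limit M = mx_limit M.
Proof.
by move/(mx_limit_mul_expr i) => {2}<-; rewrite !mulmxE -!exprD addnC.
Qed.

Lemma at1_polymx (m l : nat) (A : 'M[R]_(m, l)) : at1 (polymx A) = A.
Proof. by apply/matrixP => i j; rewrite !mxE /horner_eval hornerC. Qed.

Lemma exprZ_polymx M i : ('X *: polymx M) ^+ i = 'X^i *: polymx (M ^+ i).
Proof.
elim: i => [|i IHi]; first by rewrite !expr0 scale1r map_mx1.
by rewrite !exprS IHi -!mulmxE map_mxM -scalemxAl -scalemxAr scalerA.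
Qed.

Definition rev_char_mx M : 'M[{poly R}]_n.+1 := 1%:M - 'X *: polymx M.

Lemma rev_char_mx_update M (v : 'cV_n.+1) (p : 'rV_n.+1) :
  rev_char_mx (M + v *m p) = rev_char_mx M - 'X *: (polymx v *m polymx p).
Proof. by rewrite /rev_char_mx map_mxD map_mxM scalerDr opprD addrA. Qed.

Definition neumann_mx M : 'M[{poly R}]_n.+1 :=
  \sum_(i < n.+1) ('X *: polymx M) ^+ i.

Lemma at1_neumann_mx M : at1 (neumann_mx M) = \sum_(i < n.+1) M ^+ i.
Proof.
rewrite raddf_sum; apply: eq_bigr => i _ /=.
rewrite exprZ_polymx map_mxZ /= at1_polymx /horner_eval hornerXn expr1n.
by rewrite scale1r.
Qed.

Lemma mul_rev_char_neumann M :
  rev_char_mx M *m neumann_mx M = 1%:M - 'X^(n.+1) *: polymx (mx_limit M).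
Proof. by rewrite -exprZ_polymx -opprB subrX1 -mulNr opprB. Qed.

Lemma mul_neumann_rev_char M :
  neumann_mx M *m rev_char_mx M = 1%:M - 'X^(n.+1) *: polymx (mx_limit M).
Proof.
rewrite -mul_rev_char_neumann !mulmxE; apply/esym/commr_sum => i _.
by apply/commr_sym/commrB; [apply: commr1 | apply/commr_sym/commrX].
Qed.

(* S = (1 - X) (1 - X M)^-1 *)
Definition is_resolvent M S : Prop := rev_char_mx M *m S = (1 - 'X)%:M.

Definition resolvent M : 'M[{poly R}]_n.+1 :=
  (1 - 'X) *: neumann_mx M + 'X^(n.+1) *: polymx (mx_limit M).

Lemma resolventP M : power_stable M -> is_resolvent M (resolvent M).
Proof.
move=> M_stable; rewrite /is_resolvent mulmxDr -!scalemxAr.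
rewrite mul_rev_char_neumann mulmxBl mul1mx -scalemxAl -map_mxM.
have := expr_mul_mx_limit 1 M_stable; rewrite expr1 => ->.
rewrite scalerBr scalerBr !scalerA scalemx1 mulrBl mul1r ['X * _]mulrC.
by rewrite -scalerBl addrNK.
Qed.

Lemma coefp_polymx_mul M S i :
  map_mx (coefp i) (polymx M *m S) = M *m map_mx (coefp i) S.
Proof.
apply/matrixP => a b; rewrite !mxE raddf_sum; apply: eq_bigr => c _ /=.
by rewrite !mxE coefCM.
Qed.

Lemma coefp_resolvent M S i : is_resolvent M S ->
  map_mx (coefp i) S = M ^+ i - (if i is j.+1 then M ^+ j else 0).
Proof.
rewrite /is_resolvent mulmxBl mul1mx -scalemxAl => /(canRL (subrK _)) SE.
have coefp_X j (A : 'M[{poly R}]_n.+1) :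
    map_mx (coefp j) ('X *: A) = if j is k.+1 then map_mx (coefp k) A else 0.
  by case: j => [|j]; apply/matrixP => a b; rewrite !mxE /= coefXM.
have coefp_1subX j : map_mx (coefp j) (1 - 'X)%:M =
    ((j == 0%N)%:R - (j == 1%N)%:R)%:M :> 'M[R]_n.+1.
  by apply/matrixP => a b; rewrite !mxE /= coefMn coefB coef1 coefX.
elim: i => [|i IHi]; rewrite SE map_mxD coefp_1subX coefp_X /= ?subr0 ?addr0 //.
rewrite coefp_polymx_mul IHi mulmxBr mulmxE -exprS addrCA sub0r; congr (_ + _).
case: i {IHi} => [|i] /=; last by rewrite oppr0 raddf0 sub0r -exprS.
by rewrite mulr0 subr0 raddfN.
Qed.

Lemma is_resolvent_expr M S : is_resolvent M S ->
  exists2 d, M ^+ d.+1 = M ^+ d & at1 S = M ^+ d.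
Proof.
move=> res; pose d := \max_a \max_b size (S a b).
have size_S a b : (size (S a b) <= d.+1)%N.
  by apply/leqW/(bigmax_sup a) => //; apply: (bigmax_sup b).
exists d.+1.
  apply/eqP; rewrite -subr_eq0 -(coefp_resolvent d.+2 res).
  by apply/eqP/matrixP => a b; rewrite !mxE /= nth_default // leqW.
transitivity (\sum_(0 <= i < d.+2) map_mx (coefp i) S).
  apply/matrixP => a b; rewrite mxE summxE /horner_eval.
  rewrite (horner_coef_wide _ (leqW (size_S a b))) big_mkord.
  by apply: eq_bigr => i _; rewrite mxE expr1n mulr1.
under eq_bigr => i _ do rewrite (coefp_resolvent i res).
by rewrite big_nat_recl // telescope_sumr //= subr0 addrC subrK.
Qed.

End Resolvent.

Lemma is_resolvent_limit (F : fieldType) (n : nat) (M : 'M[F]_n.+1)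
    (S : 'M[{poly F}]_n.+1) :
  is_resolvent M S -> power_stable M /\ at1 S = mx_limit M.
Proof.
move=> /is_resolvent_expr [d Md ->]; have M_stable := mx_expr_stable Md.
split; first exact/eqP.
rewrite -(expr_stable_leq Md (leq_addr n.+1 _)).
by rewrite (expr_stable_leq M_stable) ?leq_addl.
Qed.

Lemma at1_resolvent (F : fieldType) (n : nat) (M : 'M[F]_n.+1) :
  power_stable M -> at1 (resolvent M) = mx_limit M.
Proof. by move=> /resolventP/is_resolvent_limit[]. Qed.

Lemma exists_update_limit_eq0 (F : fieldType) (n : nat) (M : 'M[F]_n.+1)
    (p : 'rV_n.+1) : power_stable M ->
  exists w : 'cV_n.+1,
    power_stable (M + w *m p) /\ p *m mx_limit (M + w *m p) = 0.
Proof.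
move=> M_stable; have [pM|pM] := eqVneq (p *m mx_limit M) 0.
  by exists 0; rewrite mul0mx addr0.
have [|v0 _ pv0] := @exists_mulmx_eq1 _ _ _ (0 : 'M[F]_n.+1) (p *m mx_limit M).
  by rewrite submx0.
pose v := mx_limit M *m v0.
have Mv : M *m v = v by rewrite mulmxA -{1}[M]expr1 expr_mul_mx_limit.
have pv : p *m v = 1%:M by rewrite mulmxA.
exists (- v); set N := M + _.
pose u : 'M[{poly F}]_n.+1 := polymx v *m polymx p.
have uu : u *m u = u.
  by rewrite /u mulmxA -(mulmxA (polymx v)) -map_mxM pv map_mx1 mulmx1.
have rev_u : rev_char_mx M *m u = (1 - 'X) *: u.
  rewrite mulmxA mulmxBl mul1mx -scalemxAl -map_mxM Mv mulmxBl -scalemxAl.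
  by rewrite scalerBl scale1r.
have res_N : is_resolvent N ((1%:M - 'X *: u) *m resolvent M).
  rewrite /is_resolvent -(resolventP M_stable) mulmxA; congr (_ *m _).
  rewrite rev_char_mx_update raddfN /= mulNmx scalerN opprK -/u.
  rewrite mulmxBr mulmx1 mulmxDl -!scalemxAr rev_u -scalemxAl uu.
  by rewrite -scalerDr -scalerDl subrK scale1r addrK.
have [N_stable <-] := is_resolvent_limit res_N; split=> //.
rewrite map_mxM at1_resolvent // map_mxB map_mx1 map_mxZ map_mxM !at1_polymx /=.
rewrite /horner_eval hornerX scale1r mulmxA mulmxBr mulmx1 mulmxA pv mul1mx.
by rewrite subrr mul0mx.
Qed.

(* 1 - X T is prime to T, hence divides 1 - X. *)
Lemma poly_eq0_or_eq1 (F : fieldType) (T Q : {poly F}) :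
  (1 - 'X) * T = (1 - 'X * T) * Q -> T = 0 \/ T = 1.
Proof.
move=> TQ; have [|T0] := eqVneq T 0; [by left | right].
have dvd_1subX : 1 - 'X * T %| 1 - 'X.
  apply/dvdpP; exists (1 - 'X + 'X * Q).
  by rewrite mulrDl -mulrA [Q * _]mulrC -TQ; ring.
have size_1subXT : size (1 - 'X * T) = (size T).+1.
  have size_XT : size ('X * T) = (size T).+1 by rewrite mulrC size_mulX.
  rewrite addrC size_polyDl size_polyN size_XT // size_poly1 ltnS.
  by rewrite size_poly_gt0.
have size_1subX : size (1 - 'X : {poly F}) = 2%N.
  by rewrite -size_polyN opprB size_XsubC.
have size_T : (size T <= 1)%N.
  rewrite -ltnS -size_1subXT -size_1subX dvdp_leq //.
  by rewrite -size_poly_gt0 size_1subX.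
move: TQ T0; rewrite (size1_polyC size_T); move: T`_0 => c TQ.
rewrite polyC_eq0 => c0; have := congr1 (horner^~ c^-1) TQ.
rewrite !hornerE mulVf // subrr mul0r mulrBl mul1r mulVf //.
by move/eqP; rewrite subr_eq0 => /eqP ->.
Qed.

Section RankOneUpdate.

Variables (F : fieldType) (n : nat) (N : 'M[F]_n.+1) (p : 'rV[F]_n.+1).

(* p (1 - X N)^-1, when p annihilates the limit of N *)
Definition neumann_row : 'rV[{poly F}]_n.+1 := polymx p *m neumann_mx N.

(* p (1 - X N)^-1 v *)
Definition transfer (v : 'cV_n.+1) : {poly F} :=
  (neumann_row *m polymx v) 0 0.

Definition krylov_mx : 'M[F]_n.+1 := \matrix_(i < n.+1) (p *m N ^+ i).

Lemma neumann_row_mul v : neumann_row *m polymx v = (transfer v)%:M.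
Proof. exact: mx11_scalar. Qed.

Lemma at1_neumann_rowE : at1 neumann_row = p *m \sum_(i < n.+1) N ^+ i.
Proof. by rewrite map_mxM at1_polymx at1_neumann_mx. Qed.

Lemma at1_neumann_row_mul v : at1 neumann_row *m v = (transfer v).[1]%:M.
Proof.
by rewrite -[v in LHS]at1_polymx -map_mxM neumann_row_mul map_scalar_mx.
Qed.

Lemma krylov_mul_expr k : p *m N ^+ k = 0 -> krylov_mx *m N ^+ k = 0.
Proof.
move=> pNk; apply/row_matrixP => i; rewrite row_mul rowK row0 -mulmxA mulmxE.
by rewrite -exprD addnC exprD -mulmxE mulmxA pNk mul0mx.
Qed.

Lemma krylov_mulE (v : 'cV_n.+1) (i : 'I_n.+1) :
  (krylov_mx *m v) i 0 = (p *m N ^+ i *m v) 0 0.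
Proof.
rewrite -[p *m _](rowK (fun j : 'I_n.+1 => p *m N ^+ j)) -row_mul.
by rewrite [RHS]mxE.
Qed.

Lemma transfer_krylov v : transfer v = rVpoly (krylov_mx *m v)^T.
Proof.
rewrite [(_ *m v)^T]row_sum_delta linear_sum /transfer /neumann_row.
rewrite mulmx_sumr mulmx_suml summxE; apply: eq_bigr => i _.
rewrite linearZ /= rVpoly_delta.
rewrite exprZ_polymx -scalemxAr -scalemxAl -!map_mxM [in RHS]mxE krylov_mulE.
by move: (_ *m v) => t; rewrite !mxE mulrC mul_polyC.
Qed.

Lemma transfer_eq0 v : (transfer v == 0) = (krylov_mx *m v == 0).
Proof.
rewrite transfer_krylov -(linear0 (@rVpoly F n.+1)) (inj_eq (can_inj rVpolyK)).
by rewrite trmx_eq0.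
Qed.

Lemma transfer_eq1 v : (transfer v == 1) = (krylov_mx *m v == delta_mx 0 0).
Proof.
have <- : rVpoly (delta_mx 0 0 : 'rV[F]_n.+1) = 1 by rewrite rVpoly_delta.
rewrite transfer_krylov (inj_eq (can_inj rVpolyK)).
by rewrite -trmx_delta (inj_eq trmx_inj).
Qed.

Hypothesis N_stable : power_stable N.
Hypothesis pN0 : p *m mx_limit N = 0.

Lemma neumann_row_mul_rev_char : neumann_row *m rev_char_mx N = polymx p.
Proof.
rewrite -mulmxA mul_neumann_rev_char mulmxBr mulmx1 -scalemxAr.
by rewrite -map_mxM pN0 map_mx0 scaler0 subr0.
Qed.

Lemma polymx_mul_resolvent : polymx p *m resolvent N = (1 - 'X) *: neumann_row.
Proof.
by rewrite mulmxDr -!scalemxAr -map_mxM pN0 map_mx0 scaler0 addr0.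
Qed.

Lemma at1_neumann_row_mul_limit : at1 neumann_row *m mx_limit N = 0.
Proof.
rewrite at1_neumann_rowE -mulmxA mulmx_suml mulmx_sumr big1 // => i _.
by rewrite expr_mul_mx_limit.
Qed.

(* The Sherman-Morrison formula, with r = neumann_row and T = transfer v:
     (1 - X(N + vp))^-1 = (1 - XN)^-1 + X (1 - XN)^-1 v r / (1 - XT).
   It gives the resolvents of the next two lemmas and, read backwards, the
   equation for T in [power_stable_update]. *)
Lemma is_resolvent_update0 v : transfer v = 0 ->
  is_resolvent (N + v *m p)
    (resolvent N *m (1%:M + 'X *: (polymx v *m neumann_row))).
Proof.
move=> Tv0; rewrite /is_resolvent rev_char_mx_update mulmxA mulmxBl.
rewrite resolventP // -scalemxAl -mulmxA polymx_mul_resolvent -scalemxAr.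
rewrite mulmxDr mulmx1 mulmxBl mul_scalar_mx -!scalemxAl -!scalemxAr.
have -> : polymx v *m neumann_row *m (polymx v *m neumann_row) = 0.
  rewrite -mulmxA (mulmxA neumann_row) neumann_row_mul Tv0 raddf0 mul0mx.
  by rewrite mulmx0.
by rewrite !scaler0 subr0 !scalerA mulrC addrNK.
Qed.

Lemma is_resolvent_update1 v : transfer v = 1 -> mx_limit N *m v = 0 ->
  is_resolvent (N + v *m p)
    (resolvent N + 'X *: (neumann_mx N *m polymx v *m neumann_row)).
Proof.
move=> Tv1 Nv0; rewrite /is_resolvent rev_char_mx_update mulmxDr.
have rev_nu : rev_char_mx N *m (neumann_mx N *m polymx v) = polymx v.
  rewrite mulmxA mul_rev_char_neumann mulmxBl mul1mx -scalemxAl.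
  by rewrite -map_mxM Nv0 map_mx0 scaler0 subr0.
have p_nu : polymx p *m (neumann_mx N *m polymx v) = 1%:M.
  by rewrite mulmxA neumann_row_mul Tv1.
rewrite mulmxBl resolventP // [X in _ + X]mulmxBl -!scalemxAl -!scalemxAr.
rewrite -(mulmxA (polymx v)) polymx_mul_resolvent mulmxA rev_nu.
rewrite -(mulmxA (polymx v)) (mulmxA (polymx p)) p_nu mul1mx -scalemxAr.
rewrite -scalerBr -[X in 'X *: (X - _)]scale1r -scalerBl.
by rewrite addrNK.
Qed.

Lemma stable_rank_update0 v : transfer v = 0 ->
  power_stable (N + v *m p) /\
  \rank (mx_limit (N + v *m p)) = \rank (mx_limit N).
Proof.
move=> Tv0; have [M_stable <-] := is_resolvent_limit (is_resolvent_update0 Tv0).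
split=> //; rewrite map_mxM at1_resolvent // map_mxD map_mx1 map_mxZ map_mxM /=.
set eta := at1 neumann_row; rewrite at1_polymx /horner_eval hornerX scale1r.
have eta_v : eta *m v = 0 by rewrite at1_neumann_row_mul Tv0 horner0 raddf0.
apply: mxrankMfree; apply/row_freeP; exists (1%:M - v *m eta).
rewrite mulmxDl mul1mx mulmxBr mulmx1 -mulmxA (mulmxA eta) eta_v mul0mx mulmx0.
by rewrite subr0 subrK.
Qed.

Lemma stable_rank_update1 v : transfer v = 1 -> mx_limit N *m v = 0 ->
  power_stable (N + v *m p) /\
  \rank (mx_limit (N + v *m p)) = (\rank (mx_limit N)).+1.
Proof.
move=> Tv1 Nv0.
have [M_stable <-] := is_resolvent_limit (is_resolvent_update1 Tv1 Nv0).
split=> //; rewrite map_mxD at1_resolvent // map_mxZ map_mxM /=.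
set eta := at1 neumann_row; rewrite map_mxM at1_polymx at1_neumann_mx.
rewrite {1}/horner_eval hornerX scale1r; set nu := _ *m v.
have eta_v : eta *m v = 1%:M by rewrite at1_neumann_row_mul Tv1 hornerC.
have p_nu : p *m nu = 1%:M.
  by rewrite mulmxA -at1_neumann_rowE eta_v.
have N_nu : mx_limit N *m nu = 0.
  rewrite mulmxA mulmx_sumr mulmx_suml big1 // => i _.
  by rewrite mx_limit_mul_expr.
have rank_nu_eta : \rank (nu *m eta) = 1%N.
  rewrite mxrankMfree; last by apply/row_freeP; exists v.
  rewrite -mxrank_tr; apply/eqP/row_freeP; exists p^T.
  by rewrite -trmx_mul p_nu trmx1.
rewrite mxrank_add_orthogonal_idempotent ?rank_nu_eta ?addn1 //.
- exact: mx_limit_mul_expr.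
- by rewrite mulmxA N_nu mul0mx.
- by rewrite -mulmxA at1_neumann_row_mul_limit mulmx0.
Qed.

Lemma power_stable_update v : power_stable (N + v *m p) ->
  transfer v = 0 \/ transfer v = 1 /\ mx_limit N *m v = 0.
Proof.
set M := N + v *m p => M_stable.
have row_rev : neumann_row *m rev_char_mx M = (1 - 'X * transfer v) *: polymx p.
  rewrite rev_char_mx_update mulmxBr neumann_row_mul_rev_char -scalemxAr mulmxA.
  by rewrite neumann_row_mul mul_scalar_mx scalerA scalerBl scale1r.
have row_res : (1 - 'X) *: neumann_row =
    (1 - 'X * transfer v) *: (polymx p *m resolvent M).
  by rewrite [RHS]scalemxAl -row_rev -mulmxA resolventP // mul_mx_scalar.
have [||Tv1] := @poly_eq0_or_eq1 _ (transfer v)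
    ((polymx p *m resolvent M *m polymx v) 0 0); [|by left|right; split=> //].
  have := congr1 (fun A => (A *m polymx v) 0 0) row_res.
  by rewrite /= -!scalemxAl [LHS]mxE [RHS]mxE.
have row_limit : at1 neumann_row = p *m mx_limit M.
  rewrite -at1_resolvent // -[p]at1_polymx -map_mxM; congr at1.
  have X1 : 1 - 'X != 0 :> {poly F}.
    by rewrite -size_poly_eq0 -size_polyN opprB size_XsubC.
  by apply: (scalemx_inj X1); rewrite row_res Tv1 mulr1.
have row_v : at1 neumann_row *m v = 1%:M.
  by rewrite at1_neumann_row_mul Tv1 hornerC.
have limit_update : mx_limit N *m (v *m p) *m mx_limit M = 0.
  have := mx_limit_mul_expr 1 N_stable; rewrite expr1 => limitN_mul.
  have := expr_mul_mx_limit 1 M_stable; rewrite expr1 => mul_limitM.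
  rewrite -[v *m p](addKr N) -/M mulmxDr mulmxN mulmxDl mulNmx limitN_mul.
  by rewrite -mulmxA mul_limitM addNr.
rewrite -[LHS]mulmx1 -row_v row_limit -(mulmxA _ v) 2!(mulmxA v) mulmxA.
by rewrite mulmxA limit_update mul0mx.
Qed.

Hypothesis p_neq0 : p != 0.

Lemma notin_krylov_limit : ~~ (p <= col_mx (krylov_mx *m N) (mx_limit N))%MS.
Proof.
apply: contra p_neq0 => /submxP [y]; rewrite -[y]hsubmxK mul_row_col.
move: (lsubmx y) (rsubmx y) => a b pE.
have descent k : p *m N ^+ k.+1 = 0 -> p *m N ^+ k = 0.
  move=> pNk; have pNkE : p *m N ^+ k = b *m mx_limit N.
    have KNk : krylov_mx *m (N *m N ^+ k) = 0.
      by rewrite -[N *m _]exprS krylov_mul_expr.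
    by rewrite {1}pE mulmxDl -!mulmxA mx_limit_mul_expr // KNk mulmx0 add0r.
  have <- : p *m N ^+ k *m mx_limit N = p *m N ^+ k.
    by rewrite pNkE -mulmxA mx_limit_mul_expr.
  by rewrite -mulmxA expr_mul_mx_limit.
suff p_eq0 k : p *m N ^+ k = 0 -> p = 0 by rewrite (p_eq0 _ pN0).
by elim: k => [|k IHk]; [rewrite mulmx1 | move/descent/IHk].
Qed.

Lemma exists_transfer_eq1 : exists2 v, transfer v = 1 & mx_limit N *m v = 0.
Proof.
have [v] := exists_mulmx_eq1 notin_krylov_limit.
rewrite mul_col_mx => /eqP; rewrite col_mx_eq0 => /andP[/eqP KNv /eqP Nv] pv.
exists v => //; apply/eqP; rewrite transfer_eq1; apply/eqP/colP => i.
rewrite krylov_mulE; case: i => [[|j] lt_jn]; first by rewrite mulmx1 pv !mxE.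
have := krylov_mulE (N *m v) (Ordinal (ltnW lt_jn)).
by rewrite !mulmxA KNv -(mulmxA p) mulmxE -exprSr !mxE => /= <-.
Qed.

Lemma rank_limit_lt : (\rank (mx_limit N) < n.+1)%N.
Proof.
have [v Tv1 Nv0] := exists_transfer_eq1.
by have [_ <-] := stable_rank_update1 Tv1 Nv0; apply: rank_leq_row.
Qed.

Lemma rank_krylov_limit : \rank (col_mx krylov_mx (mx_limit N)) =
  (\rank krylov_mx + \rank (mx_limit N))%N.
Proof.
rewrite -addsmxE mxrank_disjoint_sum // capmx_idempotent_eq0 //.
  exact: mx_limit_mul_expr.
exact: krylov_mul_expr.
Qed.

End RankOneUpdate.

Lemma card_transfer (F : finFieldType) (n : nat) (N : 'M[F]_n.+1)
    (p : 'rV_n.+1) : power_stable N -> p *m mx_limit N = 0 -> p != 0 ->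
  #|[set v | transfer N p v == 0]| =
  (#|[set v | ((transfer N p v == 1) && (mx_limit N *m v == 0))%R]| *
     #|F| ^ \rank (mx_limit N))%N.
Proof.
move=> N_stable pN0 p0; set K := krylov_mx N p; set P := mx_limit N.
have [v1 /eqP Tv1 Pv1] := exists_transfer_eq1 N_stable pN0 p0.
have -> : [set v | transfer N p v == 0] = [set v | K *m v == 0].
  by apply/setP => v; rewrite !inE transfer_eq0.
have -> : [set v | (transfer N p v == 1) && (P *m v == 0)] =
    [set v | col_mx K P *m v == col_mx (delta_mx 0 0) 0].
  apply/setP => v; rewrite !inE transfer_eq1 mul_col_mx.
  by apply/andP/eqP => [[/eqP-> /eqP->] //|/eq_col_mx[-> ->]].
have KPv1 : col_mx K P *m v1 = col_mx (delta_mx 0 0) 0.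
  by rewrite transfer_eq1 in Tv1; rewrite mul_col_mx Pv1 (eqP Tv1).
rewrite (card_mulmx_solutions (mulmx0 _ K)) (card_mulmx_solutions KPv1) -expnD.
have KP := rank_krylov_limit N_stable pN0; congr (_ ^ _)%N.
by rewrite KP subnDA subnK // leq_subRL ?rank_leq_row // -KP rank_leq_col.
Qed.

Section ReductionCoefficients.

Variables (F : finFieldType) (R : pzRingType) (qV : R).
Hypothesis qVK : #|F|%:R * qV = 1.

Lemma expr_qV_mulrn j : qV ^+ j *+ (#|F| ^ j) = 1.
Proof.
elim: j => [//|j IHj].
by rewrite exprSr expnSr mulrnA -mulrnAl IHj mul1r -mulr_natl.
Qed.

Definition rank_weight (m b : nat) : R := \prod_(b <= i < m) - qV ^+ i.

Lemma rank_weight_rec (m b : nat) : (b < m)%N ->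
  rank_weight m b *+ (#|F| ^ b) = - rank_weight m b.+1.
Proof.
move=> bm; rewrite /rank_weight big_ltn // -mulrnAl mulNrn expr_qV_mulrn.
by rewrite mulN1r.
Qed.

Definition reduction_coef (n : nat) (M : 'M[F]_n.+1) : R :=
  if power_stable M then rank_weight n.+1 (\rank (mx_limit M)) else 0.

Lemma reduction_coef_unit (n : nat) (M : 'M[F]_n.+1) :
  M \is a GRing.unit -> reduction_coef M = (M == 1)%:R.
Proof.
move=> uM; rewrite /reduction_coef /power_stable exprS -[X in _ == X]mul1r.
rewrite (inj_eq (mulIr _)) ?unitrX //.
by case: eqP => [->|//]; rewrite /mx_limit expr1n mxrank1 /rank_weight big_geq.
Qed.

Lemma reduction_coef_update (n : nat) (N : 'M[F]_n.+1) (p : 'rV_n.+1)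
    (v : 'cV_n.+1) : power_stable N -> p *m mx_limit N = 0 ->
  reduction_coef (N + v *m p) =
    (if transfer N p v == 0
     then rank_weight n.+1 (\rank (mx_limit N)) else 0) +
    (if (transfer N p v == 1) && (mx_limit N *m v == 0)
     then rank_weight n.+1 (\rank (mx_limit N)).+1 else 0).
Proof.
move=> N_stable pN0; rewrite /reduction_coef; case: eqP => [T0|T0].
  have [-> ->] := stable_rank_update0 N_stable pN0 T0.
  by rewrite T0 eq_sym oner_eq0 addr0.
rewrite add0r; case: andP => [[/eqP T1 /eqP Nv]|not_T1].
  by have [-> ->] := stable_rank_update1 N_stable pN0 T1 Nv.
case: ifP => // /(power_stable_update N_stable pN0) [//|[T1 Nv]].
by case: not_T1; rewrite T1 Nv !eqxx.
Qed.

Lemma sum_reduction_coef_line (n : nat) (M : 'M[F]_n.+1) (p : 'rV_n.+1) :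
  p != 0 -> \sum_(w : 'cV_n.+1) reduction_coef (M + w *m p) = 0.
Proof.
move=> p0; have [w1 M1_stable|unstable] :=
  pickP (fun w => power_stable (M + w *m p)); last first.
  by rewrite big1 // => w _; rewrite /reduction_coef unstable.
have [w2 []] := exists_update_limit_eq0 p M1_stable.
rewrite -addrA -mulmxDl; set N := M + _ => N_stable pN0.
rewrite (reindex_inj (addrI (w1 + w2))) /=.
under eq_bigr => v _ do
  rewrite mulmxDl addrA (reduction_coef_update v N_stable pN0).
rewrite big_split /= -!big_mkcond !sumr_const.
have := card_transfer N_stable pN0 p0; rewrite !cardsE => ->.
rewrite mulnC mulrnA (rank_weight_rec (rank_limit_lt N_stable pN0 p0)).
by rewrite mulNrn addNr.
Qed.

Variable B : lmodType R.

Lemma sum_reduction_coef_act (n k : nat) (f : 'M[F]_(n.+1, k) -> B)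
    (X : 'M_(n.+1, k)) : (k < n.+1)%N ->
  \sum_(M : 'M_n.+1) reduction_coef M *: f (M *m X) = 0.
Proof.
move=> kn; set S := \sum_M _.
have [p /sub_kermxP pX p0] : exists2 p : 'rV_n.+1, (p <= kermx X)%MS & p != 0.
  apply/rowV0Pn; rewrite kermx_eq0 /row_free neq_ltn.
  by rewrite (leq_ltn_trans (rank_leq_col X) kn).
suff S0 : S *+ (#|F| ^ n.+1) = 0.
  by rewrite -[S]scale1r -(expr_qV_mulrn n.+1) -scalerMnl scalerMnr S0 scaler0.
rewrite -[n.+1]muln1 -card_mx -sumr_const.
under eq_bigr => w _.
  rewrite /S (reindex_inj (addIr (w *m p))) /=.
  under eq_bigr => M _ do rewrite mulmxDl -(mulmxA w) pX mulmx0 addr0.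
  over.
rewrite exchange_big big1 //= => M _.
by rewrite -scaler_suml sum_reduction_coef_line // scale0r.
Qed.

Lemma singular_expansion (n k : nat) (f : 'M[F]_(n.+1, k) -> B)
    (X : 'M_(n.+1, k)) : (k < n.+1)%N ->
  f X = \sum_(M : 'M_n.+1 | (\rank M <= n)%N) - reduction_coef M *: f (M *m X).
Proof.
move=> kn; have := sum_reduction_coef_act f X kn.
rewrite (bigID (fun M : 'M_n.+1 => (\rank M <= n)%N)) /=.
rewrite [X in _ + X](bigD1 1) /=; last by rewrite mxrank1 ltnn.
rewrite reduction_coef_unit ?unitr1 // eqxx scale1r mul1mx.
rewrite [X in _ + (_ + X)]big1.
  move=> /eqP; rewrite addr0 addrC addr_eq0 => /eqP ->; rewrite -sumrN.
  by apply: eq_bigr => M _; rewrite scaleNr.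
move=> M /andP[rkM /negPf M1]; rewrite reduction_coef_unit ?M1 ?scale0r //.
by rewrite -row_free_unit /row_free eqn_leq rank_leq_row ltnNge.
Qed.

Definition low_rank_expansion (m k : nat) (M : 'M[F]_m) (a : 'M[F]_m -> R) :
    Prop := forall (f : 'M[F]_(m, k) -> B) X,
  f (M *m X) = \sum_(N : 'M_m | (\rank N <= k)%N) a N *: f (N *m X).

Lemma low_rank_expansion_self (m k : nat) (M : 'M[F]_m) :
  (\rank M <= k)%N -> low_rank_expansion k M (fun N => (N == M)%:R).
Proof.
move=> Mk f X; rewrite (bigD1 M) //= eqxx scale1r big1 ?addr0 //.
by move=> N /andP[_ /negPf ->]; rewrite scale0r.
Qed.

Lemma exists_low_rank_expansion (m k : nat) (M : 'M[F]_m) :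
  exists a, low_rank_expansion k M a.
Proof.
have [r] := ubnPleq (\rank M); elim: r M => [|r IHr] M rM;
  (have [Mk|kM] := leqP (\rank M) k;
    first by exists (fun N => (N == M)%:R); apply: low_rank_expansion_self).
  by have := leq_trans kM rM.
have kr : (k < r.+1)%N := leq_trans kM rM.
have [A [C MAC]] := mx_factor_through rM.
have [K|a aE] := fin_all_exists (P := fun (K : 'M[F]_r.+1) a =>
    (\rank K <= r)%N -> low_rank_expansion k (A *m K *m C) a).
  have [rK|_] := leqP (\rank K) r; last by exists (fun=> 0).
  have [|a aE] := IHr (A *m K *m C); last by exists a.
  apply: leq_trans rK.
  exact: leq_trans (mxrankM_maxl _ _) (mxrankM_maxr _ _).
exists (fun N => \sum_(K : 'M_r.+1 | (\rank K <= r)%N)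
  - reduction_coef K * a K N) => f X.
rewrite MAC -mulmxA (singular_expansion (fun Y => f (A *m Y)) _ kr).
under eq_bigr => K rK do rewrite !mulmxA aE // scaler_sumr.
rewrite exchange_big; apply: eq_bigr => N _ /=; rewrite scaler_suml.
by apply: eq_bigr => K _; rewrite scalerA.
Qed.

End ReductionCoefficients.

Lemma factors_through_mx (F : fieldType) (V : lmodType F) (m l n : nat)
    (M : 'M[F]_(l, m)) : (\rank M <= n)%N ->
  @factors_through (module_algebra F V) n m l
    (fun x => [ffun i => \sum_j M i j *: x j]).
Proof.
move=> /mx_factor_through [A [C ->]].
exists (fun x : {ffun 'I_m -> V} => [ffun i => \sum_j C i j *: x j]).
exists (fun y : {ffun 'I_n -> V} => [ffun i => \sum_j A i j *: y j]).
split=> [i|i|x].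
- by apply/term_operation_moduleP; exists (C i) => x; rewrite ffunE.
- by apply/term_operation_moduleP; exists (A i) => x; rewrite ffunE.
apply/ffunP => i; rewrite !ffunE.
under eq_bigr => j _ do rewrite mxE scaler_suml.
rewrite exchange_big; apply: eq_bigr => a _; rewrite ffunE scaler_sumr.
by apply: eq_bigr => j _; rewrite scalerA.
Qed.

Definition ffun_rows (T : Type) (m k : nat) (X : 'M[T]_(m, k)) :
    {ffun 'I_m -> 'rV[T]_k} := [ffun i => row i X].

Lemma ffun_rowsK (T : Type) (m k : nat) (x : {ffun 'I_m -> 'rV[T]_k}) :
  ffun_rows (\matrix_i x i) = x.
Proof. by apply/ffunP => i; rewrite ffunE rowK. Qed.

Lemma ffun_rows_mul (R : pzRingType) (m k l : nat) (M : 'M[R]_(l, m))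
    (x : {ffun 'I_m -> 'rV[R]_k}) :
  ffun_rows (M *m \matrix_i x i) = [ffun i => \sum_j M i j *: x j].
Proof.
apply/ffunP => i; rewrite !ffunE row_mul mulmx_sum_row.
by apply: eq_bigr => j _; rewrite mxE rowK.
Qed.

Theorem theorem49 (F : finFieldType) (k : nat) (hk : (0 < k)%N)
    (R : pzRingType) (B : lmodType R) (hF : invertible (#|F|%:R : R)) :
  uniformly_generated (module_algebra F 'rV[F]_k) (module_algebra R B) k
    (all_operations 'rV[F]_k B).
Proof.
move=> m _; have [qV [qVK _]] := hF.
have [a aE] := exists_low_rank_expansion qVK B k (1%:M : 'M_m).
pose L := [set M : 'M[F]_m | (\rank M <= k)%N].
pose M (j : 'I_#|L|) : 'M[F]_m := enum_val j.
exists #|L|, (fun y : {ffun 'I_#|L| -> B} => \sum_j a (M j) *: y j).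
exists (fun j x => [ffun i => \sum_l M j i l *: x l]); split.
- by apply/card_gt0P; exists 0; rewrite inE mxrank0.
- by apply/term_operation_moduleP; exists (a \o M).
- by move=> j; apply: factors_through_mx; have := enum_valP j; rewrite inE.
move=> f _ x; have := aE (f \o @ffun_rows F m k) (\matrix_i x i).
rewrite mul1mx (eq_bigl (mem L)) => [|N]; last by rewrite !inE.
rewrite big_enum_val /= ffun_rowsK => ->.
by apply: eq_bigr => j _; rewrite ffunE ffun_rows_mul.
Qed.
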